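(* Let $X,Y$ be Banach spaces and let $\mathcal{I}(X,Y)$ be a closed subspace of $\mathcal{L}(X,Y)$ containing all rank one operators. Suppose that there is a sequence $\{y_n^*\}$ in $S_{Y^*}$ such that the set $$\mathcal{A}=\{T\in\mathcal{I}(X,Y)\colon \|T\|=\|T^*y_n^*\|\text{ for some }n\in\mathbb{N}\}$$ is residual in $\mathcal{I}(X,Y)$. Then: (a) if $\operatorname{NA}(X,\mathbb{K})$ is residual in $X^*$, then $\operatorname{NA}(X,Y)\cap\mathcal{I}(X,Y)$ is residual in $\mathcal{I}(X,Y)$; (b) if $\operatorname{SE}(X)$ is dense in $X^*$, then $\operatorname{ASE}(X,Y)\cap\mathcal{I}(X,Y)$ is dense in $\mathcal{I}(X,Y)$.
   Context: A set is residual if it contains a dense $G_\delta$ set. $\operatorname{NA}(X,Y)$ is the set of $T\in\mathcal{L}(X,Y)$ with $\|T\|=\|Tx\|$ for some $x\in S_X$; $\operatorname{NA}(X,\mathbb{K})$ the norm attaining functionals. $\operatorname{SE}(X)$: functionals $x^*$ strongly exposing $B_X$ (there is $x_0\in B_X$ with $\operatorname{Re}x^*(x_0)=\sup_{B_X}\operatorname{Re}x^*$ and every sequence in $B_X$ with $\operatorname{Re}x^*(x_n)\to\operatorname{Re}x^*(x_0)$ converges in norm to $x_0$). $\operatorname{ASE}(X,Y)$: operators $T$ for which there is $x_0\in B_X$ such that $\{x_n\}\subset B_X$, $\|Tx_n\|\to\|T\|$ imply $\theta_nx_n\to x_0$ for some scalars $|\theta_n|=1$. *)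

(* Defs.v *)
From mathcomp Require Import all_boot all_order all_algebra.
From mathcomp Require Import all_classical all_reals all_analysis.
From mathcomp Require Import complex.
Import Order.TTheory GRing.Theory Num.Theory.
Import numFieldNormedType.Exports.
Set Implicit Arguments. Unset Strict Implicit. Unset Printing Implicit Defensive.
Local Open Scope classical_set_scope.
Local Open Scope ring_scope.

Definition scal (R : realType) (b : bool) : numFieldType :=
  if b then (R[i] : numFieldType) else (R : numFieldType).

Definition Kspace (R : realType) (b : bool) : normedModType (scal R b) :=
  (scal R b)^o.

Definition ReK (R : realType) (b : bool) : scal R b -> R :=
  if b as c return scal R c -> R then (fun z : R[i] => complex.Re z)
  else (fun x : R => x).

Section Defs.
Variables (R : realType) (b : bool).
Local Notation K := (scal R b).

Definition nrm {X : normedModType K} (x : X) : R := ReK `|x|.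

Definition unit_ball (X : normedModType K) : set X := [set x | nrm x <= 1].

Definition bl {X Y : normedModType K} (f : X -> Y) : Prop :=
  linear f /\ exists M : R, forall x, nrm (f x) <= M * nrm x.

Definition opnorm {X Y : normedModType K} (f : X -> Y) : R :=
  sup [set nrm (f x) | x in @unit_ball X].

Definition opdist {X Y : normedModType K} (S T : X -> Y) : R :=
  opnorm (fun x => S x - T x).

Definition closed_op_subspace_rank1 {X Y : normedModType K} (I : set (X -> Y)) : Prop :=
  [/\ (forall T, I T -> bl T),
      I (fun _ => 0),
      (forall (a : K) S T, I S -> I T -> I (fun x => a *: S x + T x)),
      (forall (Tn : nat -> X -> Y) (T : X -> Y), bl T -> (forall n, I (Tn n)) ->
          (fun n => opdist (Tn n) T) @ \oo --> (0 : R) -> I T) &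
      (forall (xs : X -> Kspace R b) (y : Y), bl xs -> I (fun x => xs x *: y))].

Definition rel_open {X Y : normedModType K} (I U : set (X -> Y)) : Prop :=
  forall T, I T -> U T -> exists2 e : R, 0 < e &
    forall S, I S -> opdist S T < e -> U S.

Definition dense_in {X Y : normedModType K} (I D : set (X -> Y)) : Prop :=
  forall T, I T -> forall e : R, 0 < e -> exists S, [/\ I S, D S & opdist S T < e].

Definition residual_in {X Y : normedModType K} (I A : set (X -> Y)) : Prop :=
  exists U : nat -> set (X -> Y),
    [/\ (forall n, rel_open I (U n)),
        dense_in I (fun T => forall n, U n T) &
        (forall T, I T -> (forall n, U n T) -> A T)].

Definition NA {X Y : normedModType K} : set (X -> Y) :=
  [set T | bl T /\ exists x : X, nrm x = 1 /\ opnorm T = nrm (T x)].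

Definition SE {X : normedModType K} : set (X -> Kspace R b) :=
  [set xs | bl xs /\ exists x0 : X, [/\ nrm x0 <= 1,
     ReK (xs x0) = sup [set ReK (xs x) | x in @unit_ball X] &
     forall u : nat -> X, (forall n, nrm (u n) <= 1) ->
        (fun n => ReK (xs (u n))) @ \oo --> ReK (xs x0) ->
        u @ \oo --> x0]].

Definition ASE {X Y : normedModType K} : set (X -> Y) :=
  [set T | bl T /\ exists x0 : X, nrm x0 <= 1 /\
     forall u : nat -> X, (forall n, nrm (u n) <= 1) ->
        (fun n => nrm (T (u n))) @ \oo --> opnorm T ->
        exists theta : nat -> K, (forall n, `|theta n| = 1) /\
          (fun n => theta n *: u n) @ \oo --> x0].

End Defs.

Arguments nrm {R b X}.
Arguments unit_ball {R b}.
Arguments bl {R b X Y}.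
Arguments opnorm {R b X Y}.
Arguments opdist {R b X Y}.
Arguments closed_op_subspace_rank1 {R b X Y}.
Arguments rel_open {R b X Y}.
Arguments dense_in {R b X Y}.
Arguments residual_in {R b X Y}.
Arguments NA {R b X Y}.
Arguments SE {R b X}.
Arguments ASE {R b X Y}.

(* Main.v *)
(** For each [n] the map [T |-> y_n^* o T] from [I] to [X^*] is bounded, linear
    and onto (rank one operators give a bounded right inverse), so it pulls
    residual sets back to residual sets.  Since [I] is complete, Baire's theorem
    makes residual the set of those [T] with [|T| = |y_n^* o T|] for some [n] and
    [y_n^* o T] in a given residual set [P] for all [n].  For (a), [P] is the set
    of norm attaining functionals.  For (b), [SE] is a G_delta set, hence residual
    once dense; if [f = y_n^* o T] strongly exposes [x0] and [|T| = |f|], then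
    [T + e f (x) T x0] is absolutely strongly exposing at [x0] for every [e > 0]. *)
Require Import Defs.
From mathcomp Require Import all_boot all_order all_algebra.
From mathcomp Require Import all_classical all_reals all_analysis.
From mathcomp Require Import complex.
From mathcomp Require Import ring lra.
Import Order.TTheory GRing.Theory Num.Theory.
Import numFieldNormedType.Exports.
Local Open Scope classical_set_scope.
Local Open Scope ring_scope.
Set Implicit Arguments. Unset Strict Implicit. Unset Printing Implicit Defensive.

(** * Real and complex scalars: real parts, embedded reals, rotations *)

Section Scalars.
Context {R : realType} {b : bool}.
Local Notation K := (scal R b).
Implicit Types z w : K.

Lemma ReKD z w : ReK (z + w) = ReK z + ReK w.
Proof. by case: b z w => // -[? ?] [? ?]. Qed.

Lemma ReKN z : ReK (- z) = - ReK z.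
Proof. by case: b z => // -[? ?]. Qed.

Lemma ReK0 : ReK (0 : K) = 0.
Proof. by case: b. Qed.

Lemma ReK1 : ReK (1 : K) = 1.
Proof. by case: b. Qed.

Lemma ReK_ler z w : z <= w -> ReK z <= ReK w.
Proof.
case: b z w => // -[x y] [x' y'].
by rewrite lecE => /andP[].
Qed.

Lemma ReK_ltr z w : z < w -> ReK z < ReK w.
Proof.
case: b z w => // -[x y] [x' y'].
by rewrite ltcE => /andP[].
Qed.

Lemma ReKM_ge0 z w : 0 <= z -> ReK (z * w) = ReK z * ReK w.
Proof.
case: b z w => // -[x y] [x' y'].
by rewrite lecE /= => /andP[/eqP -> _]; rewrite mul0r subr0.
Qed.

Definition ofR (r : R) : K :=
  if b as c return scal R c then (r%:C)%C else r.

Lemma ofRK r : ReK (ofR r) = r.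
Proof. by rewrite /ofR; case: b. Qed.

Lemma ofR_gt0 r : 0 < r -> 0 < ofR r.
Proof. by rewrite /ofR; case: b => // r0; rewrite ltcR. Qed.

Lemma ReK_norm_ofR r : 0 < r -> ReK `|ofR r| = r.
Proof. by move=> r0; rewrite ger0_norm ?ofRK// ltW// ofR_gt0. Qed.

Lemma ReKK z : 0 <= z -> ofR (ReK z) = z.
Proof.
rewrite /ofR; case: b z => // -[x y].
by rewrite lecE /= => /andP[/eqP -> _].
Qed.

Lemma ofR_ltr r s : r < s -> ofR r < ofR s.
Proof. by rewrite /ofR; case: b => // rs; rewrite ltcR. Qed.

Lemma ler_ReK_norm z : ReK z <= ReK `|z|.
Proof.
case: b z => [z|z]; last exact: ler_norm.
by have := normc_ge_Re z; rewrite lecE => /andP[_]; exact/le_trans/ler_norm.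
Qed.

(** In the complex case, with [z = x + iy], squaring gives [x^2 + y^2 <= x^2], which kills [y]. This
    turns norm attainment by a real part into an equality of scalars. *)
Lemma ReK_norm_le z : ReK `|z| <= ReK z -> z = ofR (ReK z).
Proof.
rewrite /ofR; case: b z => // -[x y]; rewrite normc_def /= => xy.
have x0 : 0 <= x := le_trans (sqrtr_ge0 _) xy.
have : Num.sqrt (x ^+ 2 + y ^+ 2) ^+ 2 <= x ^+ 2 by rewrite lerXn2r ?nnegrE ?sqrtr_ge0.
rewrite sqr_sqrtr ?addr_ge0 ?sqr_ge0// gerDl => y0.
have : y ^+ 2 == 0 by rewrite eq_le y0 sqr_ge0.
by rewrite sqrf_eq0 => /eqP ->.
Qed.

Lemma rotate z : exists2 t : K, `|t| = 1 & t * z = `|z|.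
Proof.
have [->|z0] := eqVneq z 0; first by exists 1; rewrite ?normr1// mulr0 normr0.
exists (`|z| / z); last by rewrite divfK.
by rewrite normrM normfV normr_id divff// normr_eq0.
Qed.

End Scalars.

(** * Real-valued norms, convergence and completeness *)

Section Norm.
Context {R : realType} {b : bool}.
Local Notation K := (scal R b).

Section NormedModule.
Context {X : normedModType K}.
Implicit Types (x y : X) (a : K).

Lemma nrmE x : ofR (nrm x) = `|x|.
Proof. exact: ReKK. Qed.

Lemma nrm_ge0 x : 0 <= nrm x.
Proof. by have := ReK_ler (normr_ge0 x); rewrite ReK0. Qed.

Lemma nrmD x y : nrm (x + y) <= nrm x + nrm y.
Proof. by rewrite /nrm -ReKD; exact/ReK_ler/ler_normD. Qed.

Lemma nrmN x : nrm (- x) = nrm x.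
Proof. by rewrite /nrm normrN. Qed.

Lemma nrm0 : nrm (0 : X) = 0.
Proof. by rewrite /nrm normr0 ReK0. Qed.

Lemma nrm_distC x y : nrm (x - y) = nrm (y - x).
Proof. by rewrite -nrmN opprB. Qed.

Lemma nrm_dist x y z : nrm (x - z) <= nrm (x - y) + nrm (y - z).
Proof. by rewrite (le_trans _ (nrmD _ _))// addrA subrK. Qed.

Lemma nrmZ a x : nrm (a *: x) = ReK `|a| * nrm x.
Proof. by rewrite /nrm normrZ ReKM_ge0. Qed.

Lemma nrm_eq0 x : nrm x <= 0 -> x = 0.
Proof.
move=> x0; apply/normr0_eq0; rewrite -nrmE.
have -> : nrm x = 0 by apply/le_anti; rewrite x0 nrm_ge0.
by rewrite -[0 in LHS](@ReK0 R b) ReKK.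
Qed.

(** A positive element of [K] is an embedded positive real, so the topology, given by [K]-valued
    radii, can be tested on real ones. *)
Lemma cvg_nrm (u : nat -> X) x :
  u @ \oo --> x <-> forall e : R, 0 < e -> \forall n \near \oo, nrm (u n - x) < e.
Proof.
split=> [/cvgrPdist_lt ux e e0|ux].
  have := ux _ (ofR_gt0 e0); apply: filterS => n.
  by move/ReK_ltr; rewrite ofRK nrm_distC.
apply/cvgrPdist_lt => e e0.
have := ReK_ltr e0; rewrite ReK0 => /ux; apply: filterS => n.
by move/(@ofR_ltr _ b); rewrite nrmE ReKK ?ltW// distrC.
Qed.

End NormedModule.

Lemma nrm_cauchy {X : completeNormedModType K} (u : nat -> X) :
  (forall e : R, 0 < e -> exists N, forall n m, (N <= n)%N -> (N <= m)%N ->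
     nrm (u n - u m) < e) ->
  exists x : X, u @ \oo --> x.
Proof.
move=> cu; suff /cauchy_cvg : cauchy (u @ \oo) by exists (lim (u @ \oo)).
apply/cauchy_ballP => e e0.
have := ReK_ltr e0; rewrite ReK0 => /cu [N uN].
exists (u @` [set n | (N <= n)%N], u @` [set n | (N <= n)%N]) => /=.
  by split; exists N => // n /= Nn; exists n.
move=> [_ _] /= [[n Nn <-] [m Nm <-]]; rewrite -ball_normE /=.
by have /(@ofR_ltr _ b) := uN n m Nn Nm; rewrite nrmE ReKK ?ltW.
Qed.

End Norm.

(** * Operator norms, distances between operators, and functionals *)

Section OperatorNorm.
Context {R : realType} {b : bool}.
Local Notation K := (scal R b).

Section Linear.
Context {X Y : normedModType K}.
Implicit Types (x y : X) (f g : X -> Y) (a : K) (c : R).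

Lemma bl0 f : bl f -> f 0 = 0.
Proof.
case=> lf _; have := lf (-1) 0 0.
by rewrite scaler0 addr0 scaleN1r addNr.
Qed.

Lemma blZ f a x : bl f -> f (a *: x) = a *: f x.
Proof. by move=> bf; have := bf.1 a x 0; rewrite !addr0 bl0// addr0. Qed.

Lemma blB f x y : bl f -> f (x - y) = f x - f y.
Proof. by case=> lf _; rewrite addrC -scaleN1r lf scaleN1r addrC. Qed.

Lemma opnorm_ub f x : bl f -> nrm x <= 1 -> nrm (f x) <= opnorm f.
Proof.
move=> [lf [M fM]] x1; apply: ub_le_sup; last by exists x.
(* [M] is not assumed nonnegative, hence the absolute value. *)
exists `|M| => _ [z z1 <-]; rewrite (le_trans (fM z))//.
rewrite (le_trans (ler_norm _))// normrM (ger0_norm (nrm_ge0 z)).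
by rewrite ler_piMr.
Qed.

Lemma opnorm_le f c : (forall x, nrm x <= 1 -> nrm (f x) <= c) -> opnorm f <= c.
Proof.
move=> fc; apply: ge_sup; first by exists (nrm (f 0)), 0; rewrite //= /unit_ball/= nrm0.
by move=> _ [x x1 <-]; exact: fc.
Qed.

Lemma opnorm_ge0 f : bl f -> 0 <= opnorm f.
Proof.
by move=> bf; have := @opnorm_ub f 0 bf; rewrite bl0// !nrm0; apply.
Qed.

Lemma ler_opnorm f x : bl f -> nrm (f x) <= opnorm f * nrm x.
Proof.
move=> bf; have [x0|x0] := leP (nrm x) 0.
  by rewrite (nrm_eq0 x0) bl0// !nrm0 mulr0.
have nE : ReK `|ofR (nrm x)^-1 : K| = (nrm x)^-1.
  by rewrite ger0_norm ?ofRK// ltW// ofR_gt0// invr_gt0.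
have := @opnorm_ub f (ofR (nrm x)^-1 *: x) bf.
rewrite blZ// !nrmZ nE mulVf ?gt_eqF// lexx mulrC => /(_ isT).
by rewrite ler_pdivrMr.
Qed.

Lemma bl_opnorm f c : linear f -> (forall x, nrm (f x) <= c * nrm x) -> bl f.
Proof. by split=> //; exists c. Qed.

Lemma bl_lin a f g : bl f -> bl g -> bl (fun x => a *: f x + g x).
Proof.
move=> bf bg; apply: (@bl_opnorm _ (ReK `|a| * opnorm f + opnorm g)) => [k x y|x].
  rewrite bf.1 bg.1 !scalerDr !scalerA addrACA (mulrC a k).
  by [].
rewrite (le_trans (nrmD _ _))// nrmZ mulrDl -mulrA lerD ?ler_opnorm//.
by rewrite ler_wpM2l ?ler_opnorm// -(@ReK0 R b) ReK_ler.
Qed.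

Lemma blZf a f : bl f -> bl (fun x => a *: f x).
Proof.
move=> bf; have := bl_lin a bf (bl_lin (-1) bf bf); congr bl.
by apply/funext => x; rewrite scaleN1r addNr addr0.
Qed.

Lemma blBf f g : bl f -> bl g -> bl (fun x => f x - g x).
Proof.
move=> bf bg; have := bl_lin (-1) bg bf; congr bl.
by apply/funext => x; rewrite scaleN1r addrC.
Qed.

Lemma opdist_ub f g x : bl f -> bl g ->
  nrm (f x - g x) <= opdist f g * nrm x.
Proof. by move=> bf bg; have := ler_opnorm x (blBf bf bg). Qed.

Lemma opdist_ge0 f g : bl f -> bl g -> 0 <= opdist f g.
Proof. by move=> bf bg; exact/opnorm_ge0/blBf. Qed.

Lemma opdist_le f g c : 0 <= c -> (forall x, nrm (f x - g x) <= c * nrm x) ->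
  opdist f g <= c.
Proof.
move=> c0 fgc; apply: opnorm_le => x x1.
by rewrite (le_trans (fgc x))// ler_piMr.
Qed.

Lemma opdist_tri g f h : bl f -> bl g -> bl h ->
  opdist f h <= opdist f g + opdist g h.
Proof.
move=> bf bg bh; apply: opdist_le => [|x]; first by rewrite addr_ge0 ?opdist_ge0.
by rewrite (le_trans (nrm_dist _ (g x) _))// mulrDl lerD ?opdist_ub.
Qed.

Lemma opdist_self f : opdist f f <= 0.
Proof. by apply: opdist_le => // x; rewrite subrr nrm0 mul0r. Qed.

End Linear.

Lemma bl_comp {X Y Z : normedModType K} (g : Y -> Z) (f : X -> Y) :
  bl f -> bl g -> bl (fun x => g (f x)).
Proof.
move=> bf bg; apply: (@bl_opnorm _ _ _ (opnorm g * opnorm f)) => [a x y|x].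
  by rewrite bf.1 bg.1.
rewrite (le_trans (ler_opnorm _ bg))// -mulrA ler_wpM2l ?opnorm_ge0//.
exact: ler_opnorm.
Qed.

Section Functionals.
Context {X : normedModType K}.
Implicit Types (x y : X) (f g : X -> Kspace R b).

Lemma ReK_functional_ub f x : bl f -> nrm x <= 1 -> ReK (f x) <= opnorm f.
Proof.
by move=> bf x1; rewrite (le_trans (ler_ReK_norm _))//; have := opnorm_ub bf x1.
Qed.

Lemma functional_rotate f x : bl f ->
  exists t : K, [/\ `|t| = 1, nrm (t *: x) = nrm x & ReK (f (t *: x)) = nrm (f x)].
Proof.
move=> bf; have [t t1 tf] := rotate (f x : K).
by exists t; rewrite nrmZ t1 ReK1 mul1r blZ//; split=> //; rewrite -[t *: _]/(t * _) tf.
Qed.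

(** A unimodular rotation makes [f x] equal to its modulus without leaving the ball. This identifies
    the supremum in [SE] with the dual norm. *)
Lemma sup_ReK f : bl f -> sup [set ReK (f x) | x in @unit_ball R b X] = opnorm f.
Proof.
move=> bf; apply/le_anti/andP; split.
  apply: ge_sup; first by exists (ReK (f 0)), 0; rewrite //= /unit_ball/= nrm0.
  by move=> _ [x x1 <-]; exact: ReK_functional_ub.
apply: opnorm_le => x x1; have [t [t1 tx <-]] := functional_rotate x bf.
apply: ub_le_sup; last by exists (t *: x) => //; rewrite /unit_ball/= tx.
by exists (opnorm f) => _ [z z1 <-]; exact: ReK_functional_ub.
Qed.

Lemma opnorm_approx f c : bl f -> c < opnorm f ->
  exists2 x, nrm x <= 1 & c < ReK (f x).
Proof.
move=> bf; rewrite -sup_ReK// => /sup_gt [].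
  by exists (ReK (f 0)), 0; rewrite //= /unit_ball/= nrm0.
by move=> _ [x x1 <-] cx; exists x.
Qed.

End Functionals.
End OperatorNorm.

(** * Baire's theorem in a closed space of operators *)

Section Baire.
Context {R : realType} {b : bool}.
Local Notation K := (scal R b).

Lemma natSinv_near (d : R) : 0 < d -> \forall n \near \oo, n.+1%:R^-1 < d.
Proof. by move=> d0; exact: near_infty_natSinv_lt (PosNum d0). Qed.

Lemma cvg_dist (u : nat -> R) (l : R) :
  u @ \oo --> l <-> forall e : R, 0 < e -> \forall n \near \oo, `|l - u n| < e.
Proof. exact: cvgrPdist_lt. Qed.

Lemma squeeze_natSinv (u : nat -> R) (l : R) :
  (forall n, l - n.+1%:R^-1 < u n) -> (forall n, u n <= l) -> u @ \oo --> l.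
Proof.
move=> lu ul; apply/cvg_dist => d /natSinv_near; apply: filterS => n nd.
rewrite ger0_norm ?subr_ge0//; rewrite ltrBlDr -ltrBlDl.
by apply: le_lt_trans (lu n); rewrite lerB// ltW.
Qed.

Lemma vanishing_le0 (r : nat -> R) (v c : R) :
  (forall e, 0 < e -> \forall n \near \oo, r n < e) -> (forall n, 0 <= r n) ->
  (forall n, v <= r n * c) -> v <= 0.
Proof.
move=> r0 rge0 vr; apply/ler_addgt0Pr => e e0; rewrite add0r.
have c0 : 0 < `|c| + 1 by rewrite ltr_wpDl.
have [n _ /(_ n (leqnn n)) /= rn] := r0 _ (divr_gt0 e0 c0).
have := vr n; rewrite ltr_pdivlMr// in rn.
have := ler_wpM2l (rge0 n) (ler_norm c); have := rge0 n; lra.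
Qed.

(** The values [T n x] are Cauchy, so completeness of [Y] gives a pointwise limit; letting [m] grow
    passes the bound [r n] on to the limit. *)
Lemma operator_limit {X : normedModType K} {Y : completeNormedModType K}
    (T : nat -> X -> Y) (r : nat -> R) :
  (forall n, bl (T n)) ->
  (forall e, 0 < e -> \forall n \near \oo, r n < e) ->
  (forall n m, (n <= m)%N -> opdist (T m) (T n) <= r n) ->
  exists2 L : X -> Y, bl L & forall n, opdist (T n) L <= r n.
Proof.
move=> bT r_small Tr.
have rge0 n : 0 <= r n.
  by rewrite (le_trans (opdist_ge0 (bT n) (bT n)))// Tr.
have Trx n m x : (n <= m)%N -> nrm (T m x - T n x) <= r n * nrm x.
  move=> nm; rewrite (le_trans (opdist_ub _ (bT m) (bT n)))//.
  by rewrite ler_wpM2r ?nrm_ge0 ?Tr.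
have /choice[L LP] x : exists l : Y, forall n, nrm (T n x - l) <= r n * nrm x.
  have [e e0|l /cvg_nrm Tl] := @nrm_cauchy _ _ _ (T ^~ x).
    have c0 : 0 < 2 * (nrm x + 1) by have := nrm_ge0 x; lra.
    have [N _ /(_ N (leqnn N)) /= rN] := r_small _ (divr_gt0 e0 c0).
    exists N => n m Nn Nm.
    have := nrm_dist (T n x) (T N x) (T m x); rewrite (nrm_distC (T N x)).
    have := Trx _ _ x Nn; have := Trx _ _ x Nm.
    rewrite ltr_pdivlMr// in rN; have := rge0 N; lra.
  exists l => n; apply/ler_addgt0Pr => e /Tl [N _ Nl].
  have := Nl _ (leq_maxl N n); have := Trx _ _ x (leq_maxr N n).
  move=> /=; have := nrm_dist (T n x) (T (maxn N n) x) l.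
  rewrite (nrm_distC (T n x) (T _ x)); lra.
exists L; last by move=> n; apply: opdist_le => // x; exact: LP.
apply: (@bl_opnorm _ _ _ _ _ (opnorm (T 0%N) + r 0%N)) => [a x y|x]; last first.
  have := LP x 0%N; have := ler_opnorm x (bT 0%N).
  have := nrmD (T 0%N x) (L x - T 0%N x); rewrite (addrC (T _ _)) subrK.
  rewrite (nrm_distC (L x)); lra.
apply/eqP; rewrite -subr_eq0; apply/eqP/nrm_eq0.
(* Since [T n] is linear, the linearity defect of [L] is at most [r n] times a constant independent
   of [n]. *)
apply: (@vanishing_le0 r _ (nrm (a *: x + y) + ReK `|a| * nrm x + nrm y)) => // n.
have := nrm_dist (L (a *: x + y)) (T n (a *: x + y)) (a *: L x + L y).
rewrite (nrm_distC (L _) (T n _)) {2}(bT n).1 opprD addrACA -scalerBr.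
have := nrmD (a *: (T n x - L x)) (T n y - L y); rewrite nrmZ.
have a0 : 0 <= ReK `|a| by rewrite -(@ReK0 R b) ReK_ler.
have := ler_wpM2l a0 (LP x n); have := LP y n; have := LP (a *: x + y) n.
lra.
Qed.

Context {X : normedModType K} {Y : completeNormedModType K}.
Variable I : set (X -> Y).
Hypothesis Icl : closed_op_subspace_rank1 I.

Lemma sub_bl T : I T -> bl T.
Proof. by case: Icl => + _ _ _ _; apply. Qed.

Lemma baire_step (U : set (X -> Y)) (T : X -> Y) (r d : R) :
  rel_open I U -> dense_in I U -> I T -> 0 < r -> 0 < d ->
  exists q : (X -> Y) * R, [/\ I q.1, 0 < q.2, q.2 <= d,
    opdist q.1 T + q.2 <= r & forall S, I S -> opdist S q.1 <= q.2 -> U S].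
Proof.
move=> oU dU IT r0 d0.
have [|S [IS US ST]] := dU T IT (r / 2); first by lra.
have [e e0 eU] := oU S IS US.
(* [r / 2] keeps the new closed ball inside the old one, [e / 2] keeps it inside [U], and [d] will
   force the radii to zero. *)
exists (S, Num.min (r / 2) (Num.min (e / 2) d)); split=> //=.
- by rewrite !lt_min d0 !divr_gt0.
- by rewrite !ge_min lexx !orbT.
- have : Num.min (r / 2) (Num.min (e / 2) d) <= r / 2 by rewrite ge_min lexx.
  lra.
- move=> S' IS' S'S; apply: eU => //; rewrite (le_lt_trans S'S)//.
  have : Num.min (r / 2) (Num.min (e / 2) d) <= e / 2.
    by rewrite !ge_min lexx orbT.
  lra.
Qed.

(** Nested closed balls with vanishing radii are chosen, the next one inside [U n] at stage [n].
    Their centres converge by completeness of [Y], and the limit stays in [I] because [I] is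
    closed. *)
Lemma baire (U : nat -> set (X -> Y)) :
  (forall n, rel_open I (U n)) -> (forall n, dense_in I (U n)) ->
  dense_in I (fun T => forall n, U n T).
Proof.
move=> oU dU T0 IT0 e e0.
pose good n (p q : (X -> Y) * R) := [/\ I q.1, 0 < q.2, q.2 <= n.+1%:R^-1,
  opdist q.1 p.1 + q.2 <= p.2 & forall S, I S -> opdist S q.1 <= q.2 -> U n S].
(* [choice] needs a total relation, so validity of the ball becomes a premise and an invalid ball is
   sent to itself. *)
have /choice[F FP] (np : nat * ((X -> Y) * R)) :
    exists q, I np.2.1 -> 0 < np.2.2 -> good np.1 np.2 q.
  have [[Ip p0]|np0] := pselect (I np.2.1 /\ 0 < np.2.2); last first.
    by exists np.2 => Ip p0; case: np0.
  have [|q qP] := @baire_step (U np.1) _ _ np.1.+1%:R^-1 (oU np.1) (dU np.1) Ip p0.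
    by rewrite invr_gt0.
  by exists q.
(* The initial radius [e / 2] leaves the limit strictly closer than [e] to [T0]. *)
pose p := nat_rect (fun _ => ((X -> Y) * R)%type) (T0, e / 2) (fun n q => F (n, q)).
have pP n : I (p n).1 /\ 0 < (p n).2.
  elim: n => [|n [In pn]]; first by split=> //=; lra.
  by have [] := FP (n, p n) In pn.
have pS n : good n (p n) (p n.+1) by have [In pn] := pP n; exact: (FP (n, p n)).
pose T n := (p n).1; pose r n := (p n).2.
have bT n : bl (T n) by apply/sub_bl; have [] := pP n.
(* Keeping the later radius on the left makes the induction telescope. *)
have Tr' n k : opdist (T (k + n)%N) (T n) + r (k + n)%N <= r n.
  elim: k => [|k IH]; first by rewrite add0n gerDr opdist_self.
  have := opdist_tri (bT (k.+1 + n)%N) (bT (k + n)%N) (bT n).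
  have [_ _ _ + _] := pS (k + n)%N; rewrite -/(T _) -/(T _) -/(r _) -/(r _).
  rewrite -!addSn; lra.
have Tr n m : (n <= m)%N -> opdist (T m) (T n) <= r n.
  move=> nm; have := Tr' n (m - n)%N; rewrite subnK//.
  have := (pP m).2; rewrite -/(r _); lra.
have r_small d : 0 < d -> \forall n \near \oo, r n < d.
  move=> d0; have [N _ NP] := natSinv_near d0.
  exists N.+1 => // -[//|n] /= Nn; have [_ _ + _ _] := pS n.
  by move=> /le_lt_trans; apply; exact: NP.
have [L bL TL] := operator_limit bT r_small Tr.
have distC n : opdist L (T n) <= r n.
  rewrite (le_trans _ (TL n))//; apply: opdist_le; first exact: opdist_ge0.
  by move=> x; rewrite nrm_distC opdist_ub.
have IL : I L.
  have [_ _ _ + _] := Icl; apply; [exact: bL|by move=> n; exact: (pP n).1|].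
  apply/cvgrPdist_lt => d /r_small; apply: filterS => n rn.
  rewrite sub0r normrN ger0_norm; first exact: le_lt_trans (TL n) rn.
  exact: opdist_ge0 (bT n) bL.
exists L; split=> //.
  by move=> n; have [_ _ _ _ +] := pS n; apply => //; exact: (distC n.+1).
by have := distC 0%N; rewrite /r /=; lra.
Qed.

(** The double sequence of open dense sets is re-enumerated as a single one, with the whole space at
    indices that code no pair; density then comes from [baire]. *)
Lemma residual_bigcap (A : nat -> set (X -> Y)) :
  (forall n, residual_in I (A n)) -> residual_in I (fun T => forall n, A n T).
Proof.
move=> /choice[U UP].
pose V k := if unpickle k is Some (n, m) then U n m else setT.
have oV k : rel_open I (V k).
  rewrite /V; case: (unpickle k) => [[n m]|]; first by have [] := UP n.
  by move=> T _ _; exists 1.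
have VU T : (forall k, V k T) -> forall n m, U n m T.
  by move=> VT n m; have := VT (pickle (n, m)); rewrite /V pickleK.
exists V; split=> //.
  apply: baire => // k; rewrite /V; case: (unpickle k) => [[n m]|].
    have [_ dU _] := UP n; move=> T IT e e0.
    by have [S [IS US ST]] := dU T IT e e0; exists S; split.
  move=> T IT e e0; exists T; split=> //.
  by rewrite (le_lt_trans (opdist_self _)).
by move=> T IT /VU UT n; have [_ _] := UP n; apply.
Qed.

End Baire.

(** * Residual sets: pullback by functionals, and strongly exposing functionals *)

Section Residual.
Context {R : realType} {b : bool}.
Local Notation K := (scal R b).

Lemma residual_sub {X Y : normedModType K} (I A B : set (X -> Y)) :
  residual_in I A -> (forall T, I T -> A T -> B T) -> residual_in I B.
Proof.
by move=> [U [oU dU UA]] AB; exists U; split=> // T IT UT; apply/AB/UA.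
Qed.

Lemma residual_dense {X Y : normedModType K} (I A : set (X -> Y)) :
  residual_in I A -> dense_in I A.
Proof.
move=> [U [_ dU UA]] T IT e e0; have [S [IS US ST]] := dU T IT e e0.
by exists S; split=> //; exact: UA.
Qed.

(* [T |-> f o T] is nonexpansive and has a bounded linear right inverse through
   rank one operators, so preimages of open dense sets are open dense. *)
Lemma residual_pullback {X : normedModType K} {Y : completeNormedModType K}
    (I : set (X -> Y)) (f : Y -> Kspace R b) (P : set (X -> Kspace R b)) :
  closed_op_subspace_rank1 I -> bl f -> opnorm f = 1 ->
  residual_in (@bl R b X (Kspace R b)) P ->
  residual_in I (fun T => P (fun x => f (T x))).
Proof.
move=> Icl bf f1 [V [oV dV VP]].
have bT T : I T -> bl (fun x => f (T x)).
  by move=> IT; apply: (bl_comp _ bf); exact: (sub_bl Icl).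
exists (fun n T => V n (fun x => f (T x))); split=> [n T IT VT|T IT e e0|T IT VT].
- have [e e0 eV] := oV n _ (bT T IT) VT; exists e => // S IS ST.
  apply: eV; first exact: bT; apply: le_lt_trans ST.
  have [bS bT'] : bl S /\ bl T by split; exact: (sub_bl Icl).
  apply: opdist_le => [|x]; first exact: opdist_ge0.
  rewrite -blB// (le_trans (ler_opnorm _ bf))// f1 mul1r.
  exact: opdist_ub.
(* The bound [1/2] makes the inverse of [f y] at most 2 in modulus, which is why [g] is taken within
   [e / 2] below. *)
- have [y y1 fy] : exists2 y, nrm y <= 1 & 2^-1 < ReK (f y).
    by apply: opnorm_approx => //; rewrite f1; lra.
  have ny : 2^-1 < nrm (f y) by apply: lt_le_trans (ler_ReK_norm _).
  have fy0 : (f y : K) != 0.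
    by apply/eqP => fy0; move: fy; rewrite fy0 ReK0 ltNge invr_ge0 ler0n.
  have [|g [bg Vg gT]] := dV _ (bT T IT) (e / 2); first by lra.
  (* Scaled so that composing [f] with [T + h y] gives exactly [g]. *)
  pose h x : Kspace R b := (f y : K)^-1 *: (g x - f (T x)).
  have bh : bl h by apply: blZf; apply: blBf => //; exact: bT.
  have hE x : f (1 *: (h x *: y) + T x) = g x.
    rewrite bf.1 (blZ _ _ bf) scale1r.
    rewrite -[h x *: f y]/((f y)^-1 * (g x - f (T x)) * f y).
    by rewrite mulrAC mulVf// mul1r subrK.
  have [_ _ Ilin _ Irk] := Icl.
  exists (fun x => 1 *: (h x *: y) + T x); split.
  + by apply: (Ilin 1) => //; exact: Irk.
  + by move=> n; under eq_fun do rewrite hE.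
  + apply: le_lt_trans (_ : 2 * opdist g (fun x => f (T x)) < e); last by lra.
    have d0 := opdist_ge0 bg (bT T IT).
    apply: opdist_le => [|x]; first by lra.
    rewrite addrK scale1r nrmZ -[ReK `|h x|]/(nrm (h x)) /h nrmZ.
    set q := ReK _.
    have q0 : 0 <= q by rewrite /q -(@ReK0 R b) ReK_ler.
    have qfy : q * nrm (f y) = 1.
      by rewrite /q -nrmZ -[_ *: f y]/(_ * _) mulVf// /nrm normr1 ReK1.
    have q2 : q <= 2 by have := ler_wpM2l q0 (ltW ny); lra.
    have gTx := opdist_ub x bg (bT T IT).
    have n0 := nrm_ge0 (g x - f (T x)).
    rewrite (@le_trans _ _ (2 * nrm (g x - f (T x))))//; last by lra.
    rewrite (le_trans (ler_piMr _ y1)) ?mulr_ge0//.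
    by rewrite ler_wpM2r.
- by apply: VP => //; exact: bT.
Qed.

(** [V k] consists of the functionals with a nonempty slice of the ball of diameter at most [d k].
    Each [V k] is open and contains [SE]; conversely, arbitrarily small slices force maximizing
    sequences to converge to one common point. *)
Lemma SE_residual {X : completeNormedModType K} :
  dense_in (@bl R b X (Kspace R b)) SE -> residual_in (@bl R b X (Kspace R b)) SE.
Proof.
have [d [dgt0 small]] : exists d : nat -> R,
    (forall k, 0 < d k) /\ forall e, 0 < e -> exists k, d k < e.
  exists (fun k => k.+1%:R^-1); split=> [k|e]; first by rewrite invr_gt0.
  by move=> /natSinv_near[N _ /(_ N (leqnn N))]; exists N.
pose V k : set (X -> Kspace R b) := [set f | exists c x,
  [/\ nrm x <= 1, c < ReK (f x) & forall y z, nrm y <= 1 -> nrm z <= 1 ->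
    c < ReK (f y) -> c < ReK (f z) -> nrm (y - z) <= d k]].
move=> dSE; exists V; split=> [k f bf [c [x [x1 cx sl]]]|f bf e e0|f bf Vf].
(* For [g] closer to [f] than half the gap, the slice of [g] at the midpoint level contains [x] and
   lies in the slice of [f] at [c]. *)
- exists ((ReK (f x) - c) / 2) => [|g bg gf]; first by lra.
  have gfd z : nrm z <= 1 -> `|ReK (g z) - ReK (f z)| < (ReK (f x) - c) / 2.
    move=> z1; apply: le_lt_trans gf.
    have gfz : nrm (g z - f z) <= opdist g f.
      by rewrite (le_trans (opdist_ub _ bg bf))// ler_piMr// opdist_ge0.
    rewrite ler_norml -ReKN -ReKD (le_trans (ler_ReK_norm _) gfz) andbT.
    rewrite lerNl -ReKN (le_trans (ler_ReK_norm _))//.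
    by have := gfz; rewrite -nrmN.
  exists ((ReK (f x) + c) / 2), x; split=> // [|y z y1 z1].
    by have := gfd x x1; rewrite ltr_norml; lra.
  move=> cy cz; apply: sl => //.
    by have := gfd y y1; rewrite ltr_norml; lra.
  by have := gfd z z1; rewrite ltr_norml; lra.
- have [g [bg gSE gf]] := dSE f bf e e0; exists g; split=> // k {gf}.
  have [_ [x [x1 gx sx]]] := gSE.
  apply: contrapT => nV.
  rewrite sup_ReK// in gx.
  (* Were [g] outside [V k], slices at levels approaching the maximum would contain pairs more than
     [d k] apart, yet strong exposure sends both members to [x]. *)
  have /choice[u uP] (n : nat) : exists yz : X * X,
      [/\ nrm yz.1 <= 1, nrm yz.2 <= 1, ReK (g x) - n.+1%:R^-1 < ReK (g yz.1),
        ReK (g x) - n.+1%:R^-1 < ReK (g yz.2) & d k < nrm (yz.1 - yz.2)].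
    apply: contrapT => nyz; apply: nV.
    exists (ReK (g x) - n.+1%:R^-1), x; split=> //.
      by rewrite gtrBl invr_gt0.
    move=> y z y1 z1 gy gz; rewrite leNgt; apply/negP => yz; apply: nyz.
    by exists (y, z).
  have lim (v : nat -> X) : (forall n, nrm (v n) <= 1) ->
      (forall n, ReK (g x) - n.+1%:R^-1 < ReK (g (v n))) -> v @ \oo --> x.
    move=> v1 gv; apply: sx => //; apply: squeeze_natSinv gv _ => n.
    by rewrite gx ReK_functional_ub.
  have k0 : 0 < d k / 2 by rewrite divr_gt0.
  have /cvg_nrm/(_ _ k0) l1 : (fun n => (u n).1) @ \oo --> x.
    by apply: lim => n; have [] := uP n.
  have /cvg_nrm/(_ _ k0) l2 : (fun n => (u n).2) @ \oo --> x.
    by apply: lim => n; have [] := uP n.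
  have [N _ /(_ N (leqnn N)) /= [N1 N2]] := filterI l1 l2.
  have [_ _ _ _] := uP N; have := nrm_dist (u N).1 x (u N).2.
  rewrite (nrm_distC x); lra.
- split=> //.
  (* A maximizing sequence eventually stays in each small slice, so it is Cauchy. *)
  have cl (u : nat -> X) : (forall n, nrm (u n) <= 1) ->
      (fun n => ReK (f (u n))) @ \oo --> opnorm f -> exists x : X, u @ \oo --> x.
    move=> u1 fu; apply: nrm_cauchy => e /small [k ke].
    have [c [x [x1 cx sl]]] := Vf k.
    have cf : 0 < opnorm f - c by have := ReK_functional_ub bf x1; lra.
    have [N _ NP] := (cvg_dist _ _).1 fu _ cf.
    have cu n : (N <= n)%N -> c < ReK (f (u n)).
      by move=> /NP /=; rewrite ltr_norml; lra.
    by exists N => n m Nn Nm; apply: le_lt_trans ke; apply: sl; rewrite ?cu.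
  have /choice[u uP] (n : nat) : exists x, nrm x <= 1 /\ opnorm f - n.+1%:R^-1 < ReK (f x).
    have [|x x1 fx] := @opnorm_approx _ _ _ f (opnorm f - n.+1%:R^-1) bf.
      by rewrite gtrBl invr_gt0.
    by exists x.
  have u1 n : nrm (u n) <= 1 by have [] := uP n.
  have fu : (fun n => ReK (f (u n))) @ \oo --> opnorm f.
    apply: squeeze_natSinv => n; last exact: ReK_functional_ub.
    by have [_] := uP n.
  have [x ux] := cl u u1 fu.
  have x1 : nrm x <= 1.
    apply/ler_addgt0Pr => e e0; have /cvg_nrm/(_ _ e0) [N _ /(_ N (leqnn N)) /= uN] := ux.
    by have := u1 N; have := nrm_dist x (u N) 0; rewrite !subr0 (nrm_distC x); lra.
  have fx : ReK (f x) = opnorm f.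
    apply/le_anti; rewrite ReK_functional_ub//=; apply/ler_addgt0Pr => e e0.
    have c0 : 0 < opnorm f + 1 by have := opnorm_ge0 bf; lra.
    (* Half of [e] pays for [f (u N - x)], half for [opnorm f - ReK (f (u N))]; the [+ 1] avoids a
       zero divisor. *)
    have /cvg_nrm/(_ _ (divr_gt0 (divr_gt0 e0 (ltr0Sn _ 1)) c0)) l1 := ux.
    have [N _ /(_ N (leqnn N)) /= [N1 N2]] :=
      filterI l1 ((cvg_dist _ _).1 fu _ (divr_gt0 e0 (ltr0Sn _ 1))).
    have := ler_ReK_norm (f (u N - x)); have := ler_opnorm (u N - x) bf.
    rewrite -[ReK `|f (u N - x)|]/(nrm _) {2}(blB _ _ bf) ReKD ReKN.
    move: N2; rewrite ltr_norml ltr_pdivlMr// in N1 *.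
    have := nrm_ge0 (u N - x); lra.
  exists x; split=> [//||v v1].
    by rewrite sup_ReK.
  rewrite fx => fv;
  apply/cvg_nrm => e /small [k ke].
  (* [x] attains the norm, hence lies in every slice, and [v n] is within [d k] of it once it enters
     the slice. *)
  have [c [z [z1 cz sl]]] := Vf k.
  have cf : 0 < opnorm f - c by have := ReK_functional_ub bf z1; lra.
  have := (cvg_dist _ _).1 fv _ cf; apply: filterS => n /=.
  rewrite ltr_norml => fvn; apply: le_lt_trans ke; apply: sl => //; lra.
Qed.

End Residual.

(** * From functionals back to operators *)

Section Perturbation.
Context {R : realType} {b : bool}.
Local Notation K := (scal R b).
Context {X Y : normedModType K}.

(** Where [f o T] attains its norm, [|T| = |f (T x)| <= |T x| <= |T|]. *)
Lemma NA_functional (T : X -> Y) (f : Y -> Kspace R b) :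
  bl T -> bl f -> opnorm f = 1 -> opnorm T = opnorm (fun x => f (T x)) ->
  NA (fun x => f (T x)) -> NA T.
Proof.
move=> bT bf f1 Tf [_ [x [x1 fTx]]]; split=> //; exists x; split=> //.
apply/le_anti; rewrite opnorm_ub ?x1// andbT Tf fTx.
by rewrite (le_trans (ler_opnorm _ bf))// f1 mul1r.
Qed.

(* Adding [e g (x) T x0], where [g = f o T] is strongly exposing at [x0], makes
   every norming sequence of the perturbed operator norming for [g]. *)
Lemma ASE_perturbation (T : X -> Y) (f : Y -> Kspace R b) :
  bl T -> bl f -> opnorm f = 1 -> opnorm T = opnorm (fun x => f (T x)) ->
  SE (fun x => f (T x)) ->
  exists y : Y, forall e : R, 0 < e ->
    ASE (fun x => ofR e *: (f (T x) *: y) + T x).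
Proof.
move=> bT bf f1 Tf [bg [x0 [x01 gx0 sx0]]].
pose g x : Kspace R b := f (T x).
rewrite sup_ReK// -Tf in gx0 sx0.
have gub x : nrm x <= 1 -> nrm (g x) <= opnorm T.
  by move=> x1; rewrite Tf; exact: opnorm_ub.
have gE : g x0 = ofR (opnorm T).
  by rewrite -gx0; apply: ReK_norm_le; rewrite gx0; exact: gub.
have Tx0 : nrm (T x0) = opnorm T.
  apply/le_anti; rewrite opnorm_ub//=.
  rewrite -{1}gx0 (le_trans (ler_ReK_norm _))//.
  by rewrite -[leLHS]/(nrm (g x0)) (le_trans (ler_opnorm _ bf))// f1 mul1r.
have N0 := opnorm_ge0 bT.
exists (T x0) => e e0.
have eE : ReK `|ofR e : K| = e by exact: ReK_norm_ofR.
have bS : bl (fun x => ofR e *: (g x *: T x0) + T x).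
  apply: (bl_lin _ _ bT); apply: (@bl_opnorm _ _ _ _ _ (opnorm T * opnorm T)) => [a x y|x].
    by rewrite /g bT.1 bf.1 scalerDl scalerA.
  rewrite nrmZ Tx0 -[ReK _]/(nrm (g x)) mulrAC ler_wpM2r//.
  by rewrite Tf; exact: ler_opnorm.
have Sub x : nrm (ofR e *: (g x *: T x0) + T x) <= e * (nrm (g x) * opnorm T) + nrm (T x).
  by rewrite (le_trans (nrmD _ _))// 2!nrmZ eE Tx0.
(* By [gE], both summands at [x0] are nonnegative multiples of [T x0], so their norms add without
   cancellation. *)
have Slb : e * (opnorm T * opnorm T) + opnorm T <= opnorm (fun x => ofR e *: (g x *: T x0) + T x).
  apply: le_trans (opnorm_ub bS x01).
  rewrite gE -[X in _ *: _ + X]scale1r scalerA -scalerDl nrmZ Tx0.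
  have := ler_ReK_norm (ofR e * ofR (opnorm T) + 1 : K).
  rewrite ReKD (ReKM_ge0 _ (ltW (ofR_gt0 e0))) !ofRK ReK1 => /(ler_wpM2r N0).
  by rewrite mulrDl mul1r mulrA.
split=> //; exists x0; split=> // u u1 Su.
(* The rotations turn [|g (u n)|] into a real part, so strong exposure leaves only the convergence
   of [|g (u n)|] to [|T|]. *)
have /choice[t tP] n := functional_rotate (u n) bg.
exists t; split=> [n|]; first by have [] := tP n.
apply: sx0 => [n|]; first by have [_ ->] := tP n.
rewrite gx0; have -> : (fun n => ReK (f (T (t n *: u n)))) = (fun n => nrm (g (u n))).
  by apply/funext => n; have [] := tP n.
apply/cvg_dist => d d0.
(* For [T = 0] the later division by [e |T|] is impossible, but [g] vanishes as well. *)
have [T0|T0] := leP (opnorm T) 0.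
  near=> n; have := gub _ (u1 n); have := nrm_ge0 (g (u n)); rewrite ltr_norml; lra.
(* With [S] the perturbed operator, [Slb] and [Sub] give [e |T| (|T| - |g (u n)|) <= |S| - |S (u
   n)|]; this tolerance therefore yields [d]. *)
have c0 : 0 < e * opnorm T * d by rewrite !mulr_gt0.
have := (cvg_dist _ _).1 Su _ c0; apply: filterS => n /=.
rewrite !ltr_norml => /andP[_ Sn].
have := gub _ (u1 n); have := Sub (u n); have := opnorm_ub bT (u1 n) => Tu Su' gu.
have : e * opnorm T * (opnorm T - nrm (g (u n))) < e * opnorm T * d by lra.
rewrite ltr_pM2l ?mulr_gt0//; lra.
Unshelve. all: by end_near. Qed.

End Perturbation.

(** * Combining the residual sets to obtain both conclusions *)

Unset Implicit Arguments.

Theorem theorem3p15 (R : realType) (b : bool)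
    (X Y : completeNormedModType (scal R b))
    (I : set (X -> Y)) (ys : nat -> Y -> Kspace R b) :
  closed_op_subspace_rank1 I ->
  (forall n, bl (ys n) /\ opnorm (ys n) = 1) ->
  residual_in I [set T | I T /\ exists n, opnorm T = opnorm (fun x => ys n (T x))] ->
  (residual_in (@bl R b X (Kspace R b)) NA ->
     residual_in I [set T | NA T /\ I T]) /\
  (dense_in (@bl R b X (Kspace R b)) SE ->
     dense_in I [set T | ASE T /\ I T]).
Proof.
move=> Icl ysP Ares.
have lift P : residual_in (@bl R b X (Kspace R b)) P ->
    residual_in I [set T | exists n, opnorm T = opnorm (fun x => ys n (T x)) /\
      P (fun x => ys n (T x))].
  move=> Pres.
  (* Index 0 carries the residual set of the hypothesis, index [m + 1] the pullback of [P] by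
     [ys m]. *)
  have /(residual_bigcap Icl) : forall n, residual_in I
      (if n is m.+1 then fun T => P (fun x => ys m (T x))
       else [set T | I T /\ exists n, opnorm T = opnorm (fun x => ys n (T x))]).
    by case=> [//|n]; have [bys ys1] := ysP n; exact: (residual_pullback Icl bys ys1 Pres).
  move/residual_sub; apply=> T IT TP; have [_ [n Tn]] := TP 0%N.
  by exists n; split=> //; exact: (TP n.+1).
split=> [/lift NAres|/SE_residual/lift/residual_dense SEd T IT e e0].
  apply: residual_sub NAres _ => T IT [n [Tn NAT]]; have [bys ys1] := ysP n.
  by split=> //; apply: NA_functional NAT => //; exact: (sub_bl Icl).
have [|S [IS [n [Sn SES]] ST]] := SEd T IT (e / 2); first by lra.
have [bys ys1] := ysP n; have bS := sub_bl Icl IS.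
have [y yP] := ASE_perturbation bS bys ys1 Sn SES.
have bf := bl_comp bS bys.
have c0 : 0 < 2 * (opnorm (fun x => ys n (S x)) * nrm y + 1).
  by have := mulr_ge0 (opnorm_ge0 bf) (nrm_ge0 y); lra.
(* The added rank one term has norm at most [d |ys n o S| |y|], so this [d] spends at most the
   remaining [e / 2]; the [+ 1] keeps the divisor positive. *)
pose d := e / (2 * (opnorm (fun x => ys n (S x)) * nrm y + 1)).
have d0 : 0 < d by rewrite divr_gt0.
have [_ _ Ilin _ Irk] := Icl.
have IS' : I (fun x => ofR d *: (ys n (S x) *: y) + S x).
  by apply: (Ilin (ofR d)) => //; exact: Irk.
exists (fun x => ofR d *: (ys n (S x) *: y) + S x); split=> //.
  by split=> //; exact: yP.
have := opdist_tri (sub_bl Icl IS') bS (sub_bl Icl IT).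
have : opdist (fun x => ofR d *: (ys n (S x) *: y) + S x) S <= e / 2.
  have dE : e / 2 = d * (opnorm (fun x => ys n (S x)) * nrm y + 1).
    by rewrite /d; field; lra.
  apply: opdist_le => [|x]; first by lra.
  rewrite addrK 2!nrmZ ReK_norm_ofR// -[ReK `|ys n (S x)|]/(nrm _).
  rewrite dE -mulrA ler_pM2l//.
  have := ler_wpM2r (nrm_ge0 y) (ler_opnorm x bf); have := nrm_ge0 x; lra.
lra.
Qed.
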